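(* $$6\pi^2 = \sum_{k=0}^{\infty}\left(\frac1{64}\right)^{k}\frac{(1)_k(1)_k}{\left(\frac54\right)_k\left(\frac74\right)_k}\cdot\frac{189k^2+297k+118}{(3k+1)(3k+2)}.$$
   Context: For $k\in\mathbb{N}_0$, $(\alpha)_k=\alpha(\alpha+1)\cdots(\alpha+k-1)$ is the rising factorial (Pochhammer symbol), with $(\alpha)_0=1$. *)

(* Defs.v *)
From Stdlib Require Import Reals.
From Coquelicot Require Import Coquelicot.
Open Scope R_scope.

(* The symbol (a)_k, read as the rising (not the falling) factorial. *)
Fixpoint pochhammer (a : R) (k : nat) : R :=
  match k with
  | O => 1
  | S j => pochhammer a j * (a + INR j)
  end.

(* Main.v *)
Require Import Defs.
From Stdlib Require Import Reals Arith Lra Lia.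
From Coquelicot Require Import Coquelicot.
Open Scope R_scope.

(** Accelerating the Basel series by a Wilf-Zeilberger pair.  With
    F(k,n) = k! (2k)! (n+k)! / ((n+3k+1) (n+4k+1)!) there is a rational multiple
    G of F such that F(k,n) - F(k+1,n) = G(k,n) - G(k,n+1).  Summing over n, the
    remainders r_k = sum_n F(k,n) satisfy r_k - r_(k+1) = G(k,0), which is 1/36
    of the k-th term of the series.  Here r_0 = zeta(2) = pi^2/6, and r_k -> 0
    since F(k+1,n) <= F(k,n)/2.

    The value of zeta(2) comes from 1/sin^2 x + 1/cos^2 x = 4/sin^2(2x): the sum B_M
    of 1/sin^2(j pi/(2M)) over 0 < j < M satisfies B_(2M) = 4 B_M + 2, hence
    B_M = 2(M^2-1)/3 for M a power of 2, and 1/sin^2 x lies between 1/x^2 and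
    1/x^2 + 1. *)

(** * The Wilf-Zeilberger pair and its values at n = 0 *)

(** The factorial part common to F and G: shifting k or n multiplies it by a rational function. *)
Definition wz_weight (k n : nat) : R :=
  INR (fact k) * INR (fact (2 * k)) * INR (fact (n + k))
  / INR (fact (n + 4 * k + 1)).

Definition wz_term (k n : nat) : R :=
  wz_weight k n / (INR n + 3 * INR k + 1).

(* The general term is h(N,p,q) = (N-p-1)! p! q! / (N (N+q)!) at N = n+3k+1,
   p = 2k, q = k.  The first three summands drop h at N, N+1, N+2; the last three
   are the telescoped sums for the steps q -> q+1, p -> p+1 and p+1 -> p+2. *)
Definition wz_mate (k n : nat) : R :=
  let x := INR k in
  let y := INR n in
  wz_weight k n *
  (1 / (y + 3 * x + 1)
   + (y + x + 1) / ((y + 4 * x + 2) * (y + 3 * x + 2))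
   + (y + x + 1) * (y + x + 2)
     / ((y + 4 * x + 2) * (y + 4 * x + 3) * (y + 3 * x + 3))
   + (y + x + 1)
     * ((y + x + 2) * (y + x + 3) / (3 * x + 1)
        + (x + 1) * (y + x + 2) / (3 * x + 2)
        - (2 * x + 1) / 3)
     / ((y + 4 * x + 2) * (y + 4 * x + 3) * (y + 4 * x + 4))).

Lemma INR_fact_S (n : nat) : INR (fact (S n)) = (INR n + 1) * INR (fact n).
Proof. rewrite fact_simpl, mult_INR, S_INR. reflexivity. Qed.

Lemma wz_weight_pos (k n : nat) : 0 < wz_weight k n.
Proof.
  unfold wz_weight.
  apply Rdiv_lt_0_compat; [|apply INR_fact_lt_0].
  repeat apply Rmult_lt_0_compat; apply INR_fact_lt_0.
Qed.

Lemma wz_weight_Sn (k n : nat) :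
  wz_weight k (S n)
  = wz_weight k n * (INR n + INR k + 1) / (INR n + 4 * INR k + 2).
Proof.
  unfold wz_weight.
  replace (S n + k)%nat with (S (n + k)) by lia.
  replace (S n + 4 * k + 1)%nat with (S (n + 4 * k + 1)) by lia.
  rewrite !INR_fact_S, !plus_INR, mult_INR. simpl (INR 4). simpl (INR 1).
  pose proof (INR_fact_neq_0 (n + 4 * k + 1)).
  pose proof (pos_INR k). pose proof (pos_INR n).
  field. repeat split; lra.
Qed.

Lemma wz_weight_Sk (k n : nat) :
  wz_weight (S k) n
  = wz_weight k n
    * ((INR k + 1) * (2 * INR k + 1) * (2 * INR k + 2) * (INR n + INR k + 1))
    / ((INR n + 4 * INR k + 2) * (INR n + 4 * INR k + 3)
       * (INR n + 4 * INR k + 4) * (INR n + 4 * INR k + 5)).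
Proof.
  unfold wz_weight.
  replace (n + S k)%nat with (S (n + k)) by lia.
  replace (2 * S k)%nat with (S (S (2 * k))) by lia.
  replace (n + 4 * S k + 1)%nat with (S (S (S (S (n + 4 * k + 1))))) by lia.
  rewrite !INR_fact_S, !S_INR, !plus_INR, !mult_INR.
  simpl (INR 4). simpl (INR 1). simpl (INR 2).
  pose proof (INR_fact_neq_0 (n + 4 * k + 1)).
  pose proof (pos_INR k). pose proof (pos_INR n).
  field. repeat split; lra.
Qed.

(** Both shift ratios are rational, so the weight factors out; what remains is a rational identity
    in real x, y >= 0, where no denominator vanishes. *)
Lemma wz_pair (k n : nat) :
  wz_term k n - wz_term (S k) n = wz_mate k n - wz_mate k (S n).
Proof.
  unfold wz_term, wz_mate.
  rewrite wz_weight_Sk, wz_weight_Sn, !S_INR.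
  generalize (wz_weight k n); intros w.
  generalize (pos_INR k) (pos_INR n); generalize (INR k) (INR n); intros x y Hx Hy.
  field. repeat split; lra.
Qed.

Lemma wz_mate_0 (k : nat) :
  36 * wz_mate k 0
  = (1 / 64) ^ k
    * (pochhammer 1 k * pochhammer 1 k
       / (pochhammer (5 / 4) k * pochhammer (7 / 4) k))
    * ((189 * INR k ^ 2 + 297 * INR k + 118)
       / ((3 * INR k + 1) * (3 * INR k + 2))).
Proof.
  assert (Hp : forall a j, 0 < a -> 0 < pochhammer a j).
  { intros a j Ha; induction j as [|j IH]; simpl; [lra|].
    pose proof (pos_INR j). apply Rmult_lt_0_compat; lra. }
  (* The weight ratios produce (3/4)_k in the denominator; the prefactor comes from (3/4)_k =
     (7/4)_k * 3/(4k+3). *)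
  assert (Hw : wz_weight k 0 = (4 * INR k + 3) / 3
    * ((1 / 64) ^ k * (pochhammer 1 k * pochhammer 1 k
       / (pochhammer (5 / 4) k * pochhammer (7 / 4) k)))).
  { induction k as [|k IH].
    - unfold wz_weight; simpl; field.
    - rewrite wz_weight_Sk, IH, S_INR. cbn [pow pochhammer]. change (INR 0) with 0.
      pose proof (pos_INR k).
      pose proof (Hp (5/4) k ltac:(lra)). pose proof (Hp (7/4) k ltac:(lra)).
      field. repeat split; lra. }
  unfold wz_mate. rewrite Hw. change (INR 0) with 0.
  generalize ((1 / 64) ^ k * (pochhammer 1 k * pochhammer 1 k
       / (pochhammer (5 / 4) k * pochhammer (7 / 4) k))); intros c.
  pose proof (pos_INR k).
  field. repeat split; lra.
Qed.

(** * Cosecant sums and the Basel series *)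

(** Peels j outer pairs off both ends until only the centre m+1 is left. On the grid of angles, the
    pairing is the reflection of x to pi/2 - x. *)
Lemma sum_n_m_fold {G : AbelianMonoid} (f : nat -> G) (m : nat) :
  sum_n_m f 1 (2 * m + 1)
  = plus (sum_n_m (fun k => plus (f k) (f (2 * m + 2 - k)%nat)) 1 m) (f (S m)).
Proof.
  assert (H : forall j, (j <= m)%nat ->
    sum_n_m f 1 (2 * m + 1)
    = plus (sum_n_m (fun k => plus (f k) (f (2 * m + 2 - k)%nat)) 1 j)
           (sum_n_m f (S j) (2 * m + 1 - j))).
  { induction j as [|j IH]; intros Hj.
    - rewrite (sum_n_m_zero _ 1 0) by lia. rewrite plus_zero_l, Nat.sub_0_r. reflexivity.
    - rewrite IH by lia. rewrite (sum_n_Sm _ 1 j) by lia.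
      replace (2 * m + 1 - j)%nat with (S (2 * m + 1 - S j)) by lia.
      rewrite (sum_n_Sm _ (S j)) by lia. rewrite (sum_Sn_m _ (S j)) by lia.
      replace (2 * m + 2 - S j)%nat with (S (2 * m + 1 - S j)) by lia.
      rewrite <- !plus_assoc. f_equal. f_equal. apply plus_comm. }
  rewrite (H m) by lia. replace (2 * m + 1 - m)%nat with (S m) by lia.
  now rewrite sum_n_n.
Qed.

Lemma sum_n_m_le_R (a b : nat -> R) (n m : nat) :
  (forall k, (n <= k <= m)%nat -> a k <= b k) -> sum_n_m a n m <= sum_n_m b n m.
Proof.
  intros H.
  (* [sum_n_m_le] wants the inequality at every index; the minimum satisfies it everywhere and
     equals [a] on the range. *)
  rewrite (sum_n_m_ext_loc a (fun k => Rmin (a k) (b k))).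
  - apply sum_n_m_le. intros k. apply Rmin_r.
  - intros k Hk. symmetry. apply Rmin_left. now apply H.
Qed.

(** The left bound is sin x < x; the right one is 1/sin^2 x = cot^2 x + 1 with cot x <= 1/x. *)
Lemma inv_sin_sqr_bounds (x : R) :
  0 < x < PI / 2 -> / x ^ 2 <= / sin x ^ 2 <= / x ^ 2 + 1.
Proof.
  intros [Hx0 Hx1].
  pose proof (sin_gt_0 x Hx0 ltac:(lra)) as Hs.
  pose proof (sin_lt_x x Hx0) as Hsx.
  (* [x <= tan x] gives [cot x ^ 2 <= 1 / x ^ 2]. *)
  assert (Hc : x * cos x <= sin x).
  { destruct (MVT_gen (fun t => sin t - t * cos t) 0 x (fun t => t * sin t))
      as [c [Hc Heq]].
    - intros t _. auto_derive; [easy|ring].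
    - intros t _. apply continuity_pt_minus; [|apply continuity_pt_mult].
      + apply continuity_sin.
      + apply derivable_continuous_pt, derivable_pt_id.
      + apply continuity_cos.
    - rewrite Rmin_left, Rmax_right in Hc by lra.
      rewrite sin_0, Rmult_0_l, !Rminus_0_r in Heq.
      assert (0 <= sin c) by (apply sin_ge_0; lra).
      assert (0 <= c * sin c * x) by (repeat apply Rmult_le_pos; lra).
      lra. }
  assert (0 < cos x) by (apply cos_gt_0; lra).
  pose proof (sin2_cos2 x) as H1. unfold Rsqr in H1.
  split.
  - apply Rinv_le_contravar; [apply pow_lt; lra|apply pow_incr; lra].
  - replace (/ sin x ^ 2) with (cos x ^ 2 / sin x ^ 2 + 1).
    + apply Rplus_le_compat_r.
      replace (/ x ^ 2) with (sin x ^ 2 / x ^ 2 / sin x ^ 2) by (field; lra).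
      apply Rmult_le_compat_r; [apply Rlt_le, Rinv_0_lt_compat, pow_lt; lra|].
      apply Rmult_le_reg_r with (x ^ 2); [apply pow_lt; lra|].
      replace (sin x ^ 2 / x ^ 2 * x ^ 2) with (sin x ^ 2) by (field; lra).
      rewrite <- Rpow_mult_distr. apply pow_incr.
      split; [apply Rmult_le_pos|]; lra.
    + replace (cos x ^ 2) with (1 - sin x ^ 2) by (simpl; lra). field. lra.
Qed.

Lemma inv_sin_sqr_double (x : R) :
  0 < x < PI / 2 ->
  / sin x ^ 2 + / sin (PI / 2 - x) ^ 2 = 4 * / sin (2 * x) ^ 2.
Proof.
  intros Hx. rewrite sin_shift, sin_2a.
  pose proof (sin_gt_0 x ltac:(lra) ltac:(lra)).
  pose proof (cos_gt_0 x ltac:(lra) ltac:(lra)).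
  pose proof (sin2_cos2 x) as H1. unfold Rsqr in H1.
  replace (4 * / (2 * sin x * cos x) ^ 2)
    with ((sin x * sin x + cos x * cos x) / (sin x ^ 2 * cos x ^ 2))
    by (rewrite H1; field; lra).
  field. lra.
Qed.

(* This is B_M with M = m + 1. *)
Definition csc_sqr_sum (m : nat) : R :=
  sum_n_m (fun k => / sin (INR k * PI / (2 * (INR m + 1))) ^ 2) 1 m.

Lemma grid_angle (k m : nat) :
  (1 <= k <= m)%nat -> 0 < INR k * PI / (2 * (INR m + 1)) < PI / 2.
Proof.
  intros [Hk Hm]. apply le_INR in Hk, Hm. simpl (INR 1) in Hk.
  pose proof PI_RGT_0. split.
  - apply Rdiv_lt_0_compat; nra.
  - apply Rmult_lt_reg_r with (2 * (INR m + 1)); [lra|].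
    field_simplify; nra.
Qed.

(** With M = m+1, the index 2m+1 belongs to 2M. The fine angles are halves of the coarse ones, so
    each reflected pair gives 4/sin^2 of a coarse angle. *)
Lemma csc_sqr_sum_double (m : nat) :
  csc_sqr_sum (2 * m + 1) = 4 * csc_sqr_sum m + 2.
Proof.
  unfold csc_sqr_sum. rewrite sum_n_m_fold.
  pose proof (pos_INR m) as Hm0.
  assert (Hm : INR (2 * m + 1) = 2 * INR m + 1)
    by (rewrite plus_INR, mult_INR; simpl; ring).
  rewrite Hm.
  change (@plus R_AbelianMonoid) with Rplus.
  f_equal.
  - rewrite <- (sum_n_m_mult_l (K := R_Ring) 4). apply sum_n_m_ext_loc. intros k Hk.
    change (@mult R_Ring) with Rmult.
    pose proof (grid_angle k m Hk).
    set (x := INR k * PI / (2 * (INR m + 1))) in *.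
    rewrite minus_INR by lia.
    replace (INR k * PI / (2 * (2 * INR m + 1 + 1))) with (x / 2)
      by (unfold x; field; lra).
    replace ((INR (2 * m + 2) - INR k) * PI / (2 * (2 * INR m + 1 + 1)))
      with (PI / 2 - x / 2)
      by (unfold x; rewrite plus_INR, mult_INR; simpl; field; lra).
    rewrite inv_sin_sqr_double by lra.
    now replace (2 * (x / 2)) with x by field.
  (* The unpaired central angle is pi/4, which contributes 2. *)
  - rewrite S_INR.
    replace ((INR m + 1) * PI / (2 * (2 * INR m + 1 + 1))) with (PI / 4)
      by (field; lra).
    rewrite sin_PI4. field_simplify_eq.
    + rewrite <- Rsqr_pow2, Rsqr_sqrt; lra.
    + apply Rgt_not_eq, sqrt_lt_R0; lra.
Qed.

Lemma csc_sqr_sum_pow2 (i : nat) :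
  csc_sqr_sum (2 ^ i - 1) = 2 / 3 * (4 ^ i - 1).
Proof.
  induction i as [|i IH].
  - unfold csc_sqr_sum. rewrite sum_n_m_zero by (simpl; lia).
    unfold zero; simpl; ring.
  - pose proof (Nat.pow_nonzero 2 i ltac:(lia)).
    replace (2 ^ S i - 1)%nat with (2 * (2 ^ i - 1) + 1)%nat
      by (rewrite Nat.pow_succ_r'; lia).
    rewrite csc_sqr_sum_double, IH. simpl. field.
Qed.

Lemma sum_inv_sqr_pow2_bounds (i : nat) :
  PI ^ 2 / 6 - PI ^ 2 * (1 / 2) ^ i
  <= sum_n_m (fun k => / INR k ^ 2) 1 (2 ^ i - 1) <= PI ^ 2 / 6.
Proof.
  set (m := (2 ^ i - 1)%nat).
  pose proof (pow_lt 2 i ltac:(lra)) as H2.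
  assert (Hm : INR m + 1 = 2 ^ i).
  { unfold m. pose proof (Nat.pow_nonzero 2 i ltac:(lia)).
    rewrite minus_INR, pow_INR by lia. change (INR 2) with 2. simpl (INR 1). ring. }
  assert (H4 : 4 ^ i = 2 ^ i * 2 ^ i) by (rewrite <- Rpow_mult_distr; f_equal; lra).
  assert (Hinv : (1 / 2) ^ i = / 2 ^ i)
    by (rewrite <- pow_inv; f_equal; lra).
  pose proof (csc_sqr_sum_pow2 i) as HB. fold m in HB.
  pose proof (pow_lt PI 2 PI_RGT_0) as HP. pose proof PI_RGT_0.
  (* [g] is 1/x^2 at the grid angles; its sum lies between B_M - (M-1) and B_M, where M = 2^i. *)
  set (g := fun k => / (INR k * PI / (2 * (INR m + 1))) ^ 2).
  assert (Hg : sum_n_m (fun k => / INR k ^ 2) 1 m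
               = PI ^ 2 / (4 * 4 ^ i) * sum_n_m g 1 m).
  { rewrite <- (sum_n_m_mult_l (K := R_Ring)). apply sum_n_m_ext_loc. intros k [Hk _].
    change (@mult R_Ring) with Rmult. unfold g. rewrite Hm, H4.
    apply le_INR in Hk. simpl (INR 1) in Hk.
    match goal with |- ?a = ?b => change (@eq R a b) end.
    field. repeat split; lra. }
  assert (H1 : sum_n_m g 1 m <= csc_sqr_sum m).
  { apply sum_n_m_le_R. intros k Hk. apply inv_sin_sqr_bounds, grid_angle, Hk. }
  assert (H3 : csc_sqr_sum m <= sum_n_m g 1 m + INR m).
  { replace (INR m) with (sum_n_m (fun _ => 1) 1 m)
      by (rewrite sum_n_m_const; replace (S m - 1)%nat with m by lia; apply Rmult_1_r).
    change Rplus with (@plus R_AbelianMonoid). rewrite <- sum_n_m_plus.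
    apply sum_n_m_le_R. intros k Hk. apply inv_sin_sqr_bounds, grid_angle, Hk. }
  assert (Hc : 0 < PI ^ 2 / (4 * 4 ^ i))
    by (apply Rdiv_lt_0_compat; rewrite ?H4; nra).
  assert (Hle : 1 <= 2 ^ i) by (pose proof (pos_INR m); lra).
  rewrite Hg, Hinv. split.
  (* Relaxing M-1 to M, the loss is pi^2 (1/(6M^2) + 1/(4M)), at most pi^2/M. *)
  - apply Rle_trans with (PI ^ 2 / (4 * 4 ^ i) * (2 / 3 * (4 ^ i - 1) - 2 ^ i)).
    + apply Rmult_le_reg_r with (2 ^ i * 2 ^ i); [nra|].
      rewrite H4. field_simplify; [|lra..]. nra.
    + apply Rmult_le_compat_l; lra.
  - apply Rle_trans with (PI ^ 2 / (4 * 4 ^ i) * (2 / 3 * (4 ^ i - 1))).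
    + apply Rmult_le_compat_l; lra.
    + apply Rmult_le_reg_r with (2 ^ i * 2 ^ i); [nra|].
      rewrite H4. field_simplify; [|lra..]. nra.
Qed.

(** Monotone boundedness gives a limit of the partial sums; the subsequence at 2^i - 1, squeezed by
    the cosecant bounds, identifies it. *)
Lemma is_series_basel : is_series (fun n => / (INR n + 1) ^ 2) (PI ^ 2 / 6).
Proof.
  set (s := fun m => sum_n_m (fun k => / INR k ^ 2) 1 m).
  assert (Hincr : forall m, s m <= s (S m)).
  { intros m. unfold s. rewrite sum_n_Sm by lia.
    change (@plus R_AbelianMonoid) with Rplus.
    pose proof (Rinv_0_lt_compat (INR (S m) ^ 2)
                  (pow_lt _ 2 (lt_0_INR (S m) ltac:(lia)))). lra. }
  assert (Hmono : forall m p, (m <= p)%nat -> s m <= s p).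
  { intros m p Hmp. induction Hmp; [lra|]. pose proof (Hincr m0). lra. }
  assert (Hbound : forall m, s m <= PI ^ 2 / 6).
  { intros m. apply Rle_trans with (s (2 ^ m - 1)%nat).
    - apply Hmono. pose proof (Nat.pow_gt_lin_r 2 m ltac:(lia)). lia.
    - apply sum_inv_sqr_pow2_bounds. }
  destruct (ex_finite_lim_seq_incr s _ Hincr Hbound) as [l Hl].
  assert (Hl' : is_lim_seq (fun i => s (2 ^ i - 1)%nat) l).
  { apply (is_lim_seq_subseq s l (fun i => 2 ^ i - 1)%nat); [|exact Hl].
    apply eventually_subseq. intros i. pose proof (Nat.pow_nonzero 2 i ltac:(lia)).
    rewrite Nat.pow_succ_r'. lia. }
  assert (Hpi : is_lim_seq (fun i => s (2 ^ i - 1)%nat) (PI ^ 2 / 6)).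
  { apply is_lim_seq_le_le with (fun i => PI ^ 2 / 6 - PI ^ 2 * (1 / 2) ^ i)
      (fun _ => PI ^ 2 / 6); [apply sum_inv_sqr_pow2_bounds| |apply is_lim_seq_const].
    replace (Finite (PI ^ 2 / 6)) with (Finite (PI ^ 2 / 6 - PI ^ 2 * 0))
      by (f_equal; ring).
    apply is_lim_seq_minus'; [apply is_lim_seq_const|].
    apply (is_lim_seq_scal_l _ (PI ^ 2) 0), is_lim_seq_geom.
    rewrite Rabs_pos_eq; lra. }
  assert (El : Finite l = Finite (PI ^ 2 / 6)).
  { rewrite <- (is_lim_seq_unique _ _ Hl'). apply is_lim_seq_unique, Hpi. }
  (* [s] starts at index 1 and the series at 0, so [s (S n)] is the partial sum up to n. *)
  rewrite El in Hl. apply is_lim_seq_incr_1 in Hl.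
  apply is_lim_seq_ext with (2 := Hl). intros n. unfold s, sum_n.
  rewrite <- sum_n_m_S. apply sum_n_m_ext. intros k. now rewrite S_INR.
Qed.

(** * Telescoping and the decay of G in n *)

Lemma is_series_telescope (g : nat -> R) :
  is_lim_seq g 0 -> is_series (fun n => g n - g (S n)) (g 0%nat).
Proof.
  intros Hg.
  change (is_lim_seq (sum_n (fun n => g n - g (S n))) (g 0%nat)).
  apply is_lim_seq_ext with (fun n => g 0%nat - g (S n)).
  - induction n as [|n IH].
    + now rewrite sum_O.
    + rewrite sum_Sn, <- IH. change (@plus R_AbelianMonoid) with Rplus.
      unfold plus; simpl; ring.
  - replace (g 0%nat) with (g 0%nat - 0) at 1 by ring.
    apply is_lim_seq_minus'; [apply is_lim_seq_const|].
    now apply is_lim_seq_incr_1 in Hg.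
Qed.

Lemma Rdiv_le_1_bounds (a b : R) : 0 <= a <= b -> 0 < b -> 0 <= a / b <= 1.
Proof.
  intros H Hb. split; [apply Rdiv_le_0_compat; lra|].
  apply Rmult_le_reg_r with b; [lra|]. field_simplify; lra.
Qed.

(** Uses (n+k)! (n+1) <= (n+k+1)! <= (n+4k+1)!. *)
Lemma wz_weight_le (k n : nat) :
  wz_weight k n <= INR (fact k) * INR (fact (2 * k)) / (INR n + 1).
Proof.
  unfold wz_weight, Rdiv. rewrite Rmult_assoc.
  pose proof (INR_fact_lt_0 k). pose proof (INR_fact_lt_0 (2 * k)).
  apply Rmult_le_compat_l; [nra|].
  assert (Hn : (fact (n + k) * S n <= fact (n + 4 * k + 1))%nat).
  { apply Nat.le_trans with (fact (S (n + k))).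
    - rewrite fact_simpl. nia.
    - apply fact_le. lia. }
  apply le_INR in Hn. rewrite mult_INR, S_INR in Hn.
  pose proof (pos_INR n). pose proof (INR_fact_lt_0 (n + 4 * k + 1)).
  apply Rmult_le_reg_r with (INR (fact (n + 4 * k + 1)) * (INR n + 1)); [nra|].
  field_simplify; lra.
Qed.

(** The weight is O(1/n) for fixed k, and its rational cofactor is bounded by 6: it is a signed sum
    of six products of fractions in [0, 1]. *)
Lemma wz_mate_lim (k : nat) : is_lim_seq (wz_mate k) 0.
Proof.
  set (c := 6 * (INR (fact k) * INR (fact (2 * k)))).
  assert (Hinv : is_lim_seq (fun n => / (INR n + 1)) 0).
  { apply is_lim_seq_ext with (fun n => / INR (S n)).
    - intros n. now rewrite S_INR.
    - apply (is_lim_seq_incr_1 (fun n => / INR n)).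
      apply (is_lim_seq_inv INR p_infty is_lim_seq_INR). easy. }
  apply is_lim_seq_abs_0.
  apply is_lim_seq_le_le with (fun _ => 0) (fun n => c * / (INR n + 1)).
  2: apply is_lim_seq_const.
  2: { replace (Finite 0) with (Rbar_mult c 0) by (simpl; f_equal; ring).
       now apply is_lim_seq_scal_l. }
  intros n. split; [apply Rabs_pos|].
  pose proof (wz_weight_le k n) as Hw. pose proof (wz_weight_pos k n).
  unfold wz_mate. cbv zeta. rewrite Rabs_mult, (Rabs_pos_eq (wz_weight k n)) by lra.
  replace (c * / (INR n + 1))
    with (INR (fact k) * INR (fact (2 * k)) / (INR n + 1) * 6)
    by (unfold c, Rdiv; ring).
  apply Rmult_le_compat; [lra|apply Rabs_pos|exact Hw|].
  generalize (pos_INR k) (pos_INR n); generalize (INR k) (INR n); intros x y Hx Hy.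
  assert (H1 := Rdiv_le_1_bounds 1 (y + 3 * x + 1) ltac:(lra) ltac:(lra)).
  assert (H2 := Rdiv_le_1_bounds (y + x + 1) (y + 4 * x + 2) ltac:(lra) ltac:(lra)).
  assert (H3 := Rdiv_le_1_bounds (y + x + 2) (y + 4 * x + 3) ltac:(lra) ltac:(lra)).
  assert (H4 := Rdiv_le_1_bounds (y + x + 3) (y + 4 * x + 4) ltac:(lra) ltac:(lra)).
  assert (H5 := Rdiv_le_1_bounds 1 (y + 3 * x + 2) ltac:(lra) ltac:(lra)).
  assert (H6 := Rdiv_le_1_bounds 1 (y + 3 * x + 3) ltac:(lra) ltac:(lra)).
  assert (H7 := Rdiv_le_1_bounds 1 (3 * x + 1) ltac:(lra) ltac:(lra)).
  assert (H8 := Rdiv_le_1_bounds (x + 1) (3 * x + 2) ltac:(lra) ltac:(lra)).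
  assert (H9 := Rdiv_le_1_bounds 1 (y + 4 * x + 4) ltac:(lra) ltac:(lra)).
  assert (HA := Rdiv_le_1_bounds (2 * x + 1) (y + 4 * x + 3) ltac:(lra) ltac:(lra)).
  assert (Hm : forall a b, 0 <= a <= 1 -> 0 <= b <= 1 -> 0 <= a * b <= 1)
    by (intros a b Ha Hb; split; nra).
  match goal with |- Rabs ?e <= 6 =>
    replace e with
     (1 / (y + 3 * x + 1)
      + (y + x + 1) / (y + 4 * x + 2) * (1 / (y + 3 * x + 2))
      + (y + x + 1) / (y + 4 * x + 2) * ((y + x + 2) / (y + 4 * x + 3))
        * (1 / (y + 3 * x + 3))
      + (y + x + 1) / (y + 4 * x + 2) * ((y + x + 2) / (y + 4 * x + 3))
        * ((y + x + 3) / (y + 4 * x + 4)) * (1 / (3 * x + 1))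
      + (y + x + 1) / (y + 4 * x + 2) * ((y + x + 2) / (y + 4 * x + 3))
        * ((x + 1) / (3 * x + 2)) * (1 / (y + 4 * x + 4))
      - (y + x + 1) / (y + 4 * x + 2) * ((2 * x + 1) / (y + 4 * x + 3))
        * (1 / (y + 4 * x + 4)) * (1 / 3)) by (field; repeat split; lra)
  end.
  assert (H10 : 0 <= 1 / 3 <= 1) by lra.
  assert (K1 := Hm _ _ H2 H5).
  assert (K2 := Hm _ _ (Hm _ _ H2 H3) H6).
  assert (K3 := Hm _ _ (Hm _ _ (Hm _ _ H2 H3) H4) H7).
  assert (K4 := Hm _ _ (Hm _ _ (Hm _ _ H2 H3) H8) H9).
  assert (K5 := Hm _ _ (Hm _ _ (Hm _ _ H2 HA) H9) H10).
  apply Rabs_le. lra.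
Qed.

(** * The remainders and the final summation *)

(** Twice the ratio F(k+1,n)/F(k,n) is still a product of five fractions in [0, 1], because 2(2k+1)
    <= n+4k+4. *)
Lemma wz_term_halving (k n : nat) : 0 <= wz_term (S k) n <= wz_term k n / 2.
Proof.
  unfold wz_term. pose proof (wz_weight_pos (S k) n).
  pose proof (pos_INR k). pose proof (pos_INR n). split.
  - apply Rdiv_le_0_compat; rewrite ?S_INR; lra.
  - rewrite wz_weight_Sk, S_INR.
    pose proof (wz_weight_pos k n).
    generalize dependent (wz_weight k n); intros w Hw.
    revert H0 H1; generalize (INR k) (INR n); intros x y Hx Hy.
    assert (H1 := Rdiv_le_1_bounds (y + x + 1) (y + 4 * x + 2) ltac:(lra) ltac:(lra)).
    assert (H2 := Rdiv_le_1_bounds (x + 1) (y + 4 * x + 3) ltac:(lra) ltac:(lra)).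
    assert (H3 := Rdiv_le_1_bounds (2 * (2 * x + 1)) (y + 4 * x + 4) ltac:(lra) ltac:(lra)).
    assert (H4 := Rdiv_le_1_bounds (2 * x + 2) (y + 4 * x + 5) ltac:(lra) ltac:(lra)).
    assert (H5 := Rdiv_le_1_bounds (y + 3 * x + 1) (y + 3 * x + 4) ltac:(lra) ltac:(lra)).
    assert (Hm : forall a b, 0 <= a <= 1 -> 0 <= b <= 1 -> 0 <= a * b <= 1)
      by (intros a b Ha Hb; split; nra).
    assert (K := Hm _ _ (Hm _ _ (Hm _ _ (Hm _ _ H1 H2) H3) H4) H5).
    set (p := _ * _) in K.
    apply Rle_trans with (w / (y + 3 * x + 1) / 2 * p).
    + apply Req_le. unfold p. field. repeat split; lra.
    + assert (0 < w / (y + 3 * x + 1)) by (apply Rdiv_lt_0_compat; lra). nra.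
Qed.

(** Given by its recurrence, so that one induction proves both convergence and value of the sum over
    n. *)
Fixpoint wz_remainder (k : nat) : R :=
  match k with
  | O => PI ^ 2 / 6
  | S j => wz_remainder j - wz_mate j 0
  end.

Lemma is_series_wz_term (k : nat) : is_series (wz_term k) (wz_remainder k).
Proof.
  induction k as [|k IH].
  - apply is_series_ext with (2 := is_series_basel). intros n.
    change (/ (INR n + 1) ^ 2 = wz_term 0 n).
    unfold wz_term, wz_weight. simpl (INR 0).
    replace (n + 0)%nat with n by lia. replace (n + 4 * 0 + 1)%nat with (S n) by lia.
    rewrite INR_fact_S. simpl fact. simpl (INR 1).
    pose proof (INR_fact_neq_0 n). pose proof (pos_INR n). field. lra.
  - pose proof (is_series_telescope _ (wz_mate_lim k)) as HG.
    apply is_series_ext with (2 := is_series_minus _ _ _ _ IH HG). intros n.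
    change (wz_term k n - (wz_mate k n - wz_mate k (S n)) = wz_term (S k) n).
    rewrite <- wz_pair. ring.
Qed.

Lemma wz_remainder_bounds (k : nat) :
  0 <= wz_remainder k <= PI ^ 2 / 6 * (1 / 2) ^ k.
Proof.
  pose proof (pow2_ge_0 PI).
  induction k as [|k IH].
  - simpl. simpl in H. lra.
  - rewrite <- (is_series_unique _ _ (is_series_wz_term (S k))).
    split.
    (* Zero is written as a series so that nonnegativity is a termwise comparison. *)
    + replace 0 with (Series (fun n => 0 * wz_term (S k) n))
        by (rewrite Series_scal_l; ring).
      apply Series_le; [|now exists (wz_remainder (S k)); apply is_series_wz_term].
      intros n. pose proof (wz_term_halving k n). lra.
    + apply Rle_trans with (Series (fun n => / 2 * wz_term k n)).
      * apply Series_le.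
        -- intros n. pose proof (wz_term_halving k n). lra.
        -- apply (ex_series_scal_l (K := R_AbsRing) (/ 2) (wz_term k)).
           now exists (wz_remainder k); apply is_series_wz_term.
      * rewrite Series_scal_l, (is_series_unique _ _ (is_series_wz_term k)).
        simpl pow at 2. lra.
Qed.

Theorem mainTheorem12 :
  is_series
    (fun k : nat =>
       (1 / 64) ^ k
       * (pochhammer 1 k * pochhammer 1 k
          / (pochhammer (5 / 4) k * pochhammer (7 / 4) k))
       * ((189 * INR k ^ 2 + 297 * INR k + 118)
          / ((3 * INR k + 1) * (3 * INR k + 2))))
    (6 * PI ^ 2).
Proof.
  (* Each term is 36 G(k,0) = 36 (r_k - r_(k+1)), so the sum telescopes to 36 r_0. *)
  apply is_series_ext with (fun k => 36 * (wz_remainder k - wz_remainder (S k))).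
  - intros k. rewrite <- wz_mate_0.
    change (36 * (wz_remainder k - (wz_remainder k - wz_mate k 0))
            = 36 * wz_mate k 0).
    ring.
  - replace (6 * PI ^ 2) with (36 * wz_remainder 0) by (simpl; field).
    apply (is_series_scal_l (K := R_AbsRing) 36
             (fun k => wz_remainder k - wz_remainder (S k)) (wz_remainder 0)).
    apply is_series_telescope.
    apply is_lim_seq_le_le with (fun _ => 0) (fun k => PI ^ 2 / 6 * (1 / 2) ^ k);
      [apply wz_remainder_bounds|apply is_lim_seq_const|].
    replace (Finite 0) with (Rbar_mult (PI ^ 2 / 6) 0) by (simpl; f_equal; ring).
    apply is_lim_seq_scal_l, is_lim_seq_geom. rewrite Rabs_pos_eq; lra.
Qed.
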